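(* Let $(V,e)$ be an absolute order unit space and let $p, q \in OP(V)$. Then the following statements are equivalent: (1) $p \dot\wedge q \in OP(V)$; (2) $p$ is absolutely compatible with $q$; (3) $p \dot\wedge q \in OP(V)$ and $p \dot\wedge q^{\prime} \in OP(V)$.
   Context: A real ordered vector space is a real vector space $V$ with a cone $V^+$ (closed under addition and multiplication by nonnegative reals); $v\le w$ means $w-v\in V^+$; $[v,w]=\{x: v\le x\le w\}$. An absolutely ordered space is a real ordered vector space with a map $|\cdot|:V\to V^+$ such that: (i) $|v|=v$ if $v\in V^+$; (ii) $|v|\pm v\in V^+$; (iii) $|kv|=|k||v|$ for $k\in\mathbb{R}$; (iv) if $|u-v|=u+v$ and $0\le w\le v$, then $|u-w|=u+w$; (v) if $|u-v|=u+v$ and $|u-w|=u+w$, then $\big|u-|v\pm w|\big|=u+|v\pm w|$. For $u,v\in V^+$, $u\perp v$ means $|u-v|=u+v$. For a norm on $V$ and $u,v\in V^+$, $u\perp_\infty v$ means $\Vert\alpha u+\beta v\Vert=\max(\Vert\alpha u\Vert,\Vert\beta v\Vert)$ for all $\alpha,\beta\in\mathbb{R}$; $u\perp_\infty^a v$ means $u_1\perp_\infty v_1$ whenever $0\le u_1\le u$, $0\le v_1\le v$. An absolute order unit space $(V,e)$ is an absolutely ordered space with $V^+$ proper and generating and an order unit $e$ (for each $v$ there is $k>0$ with $ke\pm v\in V^+$) such that $\Vert v\Vert=\inf\{k>0: ke\pm v\in V^+\}$ is a norm for which $V^+$ is closed, $u\le v\le w$ implies $\Vert v\Vert\le\max(\Vert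 u\Vert,\Vert w\Vert)$, and for $u,v\in V^+$: $u\perp v$ if and only if $u\perp_\infty^a v$. $OP(V)=\{p\in[0,e]: p\perp(e-p)\}$ (order projections); $p'=e-p$. For $u,v\in V$, $u\dot\wedge v=\frac12(u+v-|u-v|)$. Elements $u,v\in[0,e]$ are absolutely compatible if $|u-v|+|u+v-e|=e$. *)

(* Defs.v *)
From HB Require Import structures.
From mathcomp Require Import all_boot all_order all_algebra.
From mathcomp Require Import all_classical all_reals all_analysis.

Set Implicit Arguments.
Unset Strict Implicit.
Unset Printing Implicit Defensive.

Import Order.TTheory GRing.Theory Num.Theory.
Import numFieldNormedType.Exports.

Local Open Scope classical_set_scope.
Local Open Scope ring_scope.

Section OrderedSpace.
Context {R : realType} {V : lmodType R}.
Implicit Types (C : set V) (abs : V -> V) (e u v w x p : V).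

Definition is_cone C : Prop :=
  [/\ C 0,
      forall u v, C u -> C v -> C (u + v) &
      forall (k : R) v, 0 <= k -> C v -> C (k *: v)].

Definition proper_cone C : Prop := forall v, C v -> C (- v) -> v = 0.

Definition generating_cone C : Prop :=
  forall v, exists u w, [/\ C u, C w & v = u - w].

Definition cone_le C v w : Prop := C (w - v).

Definition order_interval C v w : set V :=
  [set x | cone_le C v x /\ cone_le C x w].

Definition order_unit C e : Prop :=
  forall v, exists k : R, [/\ 0 < k, C (k *: e + v) & C (k *: e - v)].

(* [abs] is the absolute value of [V]; the notation `|v| is kept for the
   norm. *)
Record absolutely_ordered C abs : Prop := AbsolutelyOrdered {
  ao_cone : is_cone C;
  ao_abs_pos : forall v, C (abs v);
  ao_abs_id : forall v, C v -> abs v = v;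
  ao_abs_dom : forall v, C (abs v + v) /\ C (abs v - v);
  ao_abs_scale : forall (k : R) v, abs (k *: v) = `|k| *: abs v;
  ao_abs_le : forall u v w, abs (u - v) = u + v ->
    cone_le C 0 w -> cone_le C w v -> abs (u - w) = u + w;
  ao_abs_add : forall u v w, abs (u - v) = u + v -> abs (u - w) = u + w ->
    abs (u - abs (v + w)) = u + abs (v + w) /\
    abs (u - abs (v - w)) = u + abs (v - w)
}.

Definition orthogonal abs u v : Prop := abs (u - v) = u + v.

Definition order_projection C abs e : set V :=
  [set p | order_interval C 0 e p /\ orthogonal abs p (e - p)].

Definition dot_meet abs u v : V := 2^-1 *: (u + v - abs (u - v)).

Definition absolutely_compatible C abs e u v : Prop :=
  [/\ order_interval C 0 e u, order_interval C 0 e v &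
      abs (u - v) + abs (u + v - e) = e].

End OrderedSpace.

Section OrderUnitSpace.
Context {R : realType} {V : normedModType R}.
Implicit Types (C : set V) (abs : V -> V) (e u v w : V).

Definition infty_orthogonal u v : Prop :=
  forall a b : R, `|a *: u + b *: v| = Num.max `|a *: u| `|b *: v|.

Definition abs_infty_orthogonal C u v : Prop :=
  forall u1 v1, order_interval C 0 u u1 -> order_interval C 0 v v1 ->
    infty_orthogonal u1 v1.

(* That the order unit seminorm is a norm is expressed by requiring it to be
   the norm of the normed module [V], whose topology [closed] refers to. *)
Record absolute_order_unit_space C abs e : Prop := AbsoluteOrderUnitSpace {
  aou_abs_ordered : absolutely_ordered C abs;
  aou_proper : proper_cone C;
  aou_generating : generating_cone C;
  aou_unit : order_unit C e;
  aou_norm : forall v,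
    `|v| = inf [set k : R | [/\ 0 < k, C (k *: e + v) & C (k *: e - v)]];
  aou_closed : closed C;
  aou_norm_le : forall u v w, cone_le C u v -> cone_le C v w ->
    `|v| <= Num.max `|u| `|w|;
  aou_orthogonal : forall u v, C u -> C v ->
    (orthogonal abs u v <-> abs_infty_orthogonal C u v)
}.

End OrderUnitSpace.

(* Main.v *)
(** For [m = dot_meet p q] the elements [p - m] and [q - m] are the positive and
    negative parts of [p - q], and compatibility of [p] and [q] amounts to
    [dot_meet p q + dot_meet p (e - q) = p].  If this holds, both summands are
    positive and orthogonal, which makes them projections.  Conversely, if [m]
    is a projection, then so is [p - m], and it is orthogonal to [q]; the norm
    characterization of orthogonality gives [p - m + q <= e], so that
    [p + q - e] is the difference of the orthogonal elements [m] and
    [e - (p - m + q)]. *)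

Require Import Defs.
From HB Require Import structures.
From mathcomp Require Import all_boot all_order all_algebra.
From mathcomp Require Import all_classical all_reals all_analysis.

Set Implicit Arguments.
Unset Strict Implicit.
Unset Printing Implicit Defensive.

Import Order.TTheory GRing.Theory Num.Theory.
Import numFieldNormedType.Exports.

Local Open Scope classical_set_scope.
Local Open Scope ring_scope.

Section OrderedSpace.
Context {R : realType} {V : lmodType R} {C : set V} {abs : V -> V}.
Hypothesis hA : absolutely_ordered C abs.
Implicit Types (e p u v w : V).

Lemma cone_add u v : C u -> C v -> C (u + v).
Proof. by case: (ao_cone hA) => _ CD _; exact: CD. Qed.

Lemma cone_scale (k : R) v : 0 <= k -> C v -> C (k *: v).
Proof. by case: (ao_cone hA) => _ _ CZ; exact: CZ. Qed.

Lemma abs_sub_sym u v : abs (u - v) = abs (v - u).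
Proof. by rewrite -opprB -[- (v - u)]scaleN1r (ao_abs_scale hA) normrN1 scale1r. Qed.

Lemma orthogonal_sym u v : Defs.orthogonal abs u v -> Defs.orthogonal abs v u.
Proof. by rewrite /Defs.orthogonal abs_sub_sym [u + v]addrC. Qed.

(** The monotonicity axiom shrinks the right-hand element only; applying it before and after a swap
    of the two sides shrinks both. *)
Lemma orthogonal_le u u1 v v1 : C u1 -> C v1 -> C (u - u1) -> C (v - v1) ->
  Defs.orthogonal abs u v -> Defs.orthogonal abs u1 v1.
Proof.
move=> u1_ge0 v1_ge0 le_u1 le_v1 uv.
have uv1 : Defs.orthogonal abs u v1.
  by apply: (ao_abs_le hA uv) => //; rewrite /cone_le subr0.
apply: orthogonal_sym; apply: (ao_abs_le hA (orthogonal_sym uv1)) => //.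
by rewrite /cone_le subr0.
Qed.

Lemma orthogonal_add u v w : C v -> C w ->
  Defs.orthogonal abs u v -> Defs.orthogonal abs u w -> Defs.orthogonal abs u (v + w).
Proof.
move=> v_ge0 w_ge0 uv uw; have [+ _] := ao_abs_add hA uv uw.
by rewrite (ao_abs_id hA (cone_add v_ge0 w_ge0)).
Qed.

Lemma order_projectionP e p :
  order_projection C abs e p <->
  [/\ C p, C (e - p) & Defs.orthogonal abs p (e - p)].
Proof.
rewrite /order_projection /order_interval /cone_le /= subr0.
by split=> [[[? ?] ?]|[? ? ?]].
Qed.

Lemma order_projection_compl e p :
  order_projection C abs e p -> order_projection C abs e (e - p).
Proof.
move=> /order_projectionP[p_ge0 p_le pp']; apply/order_projectionP.
by rewrite subKr; split=> //; exact: orthogonal_sym.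
Qed.

(** The complement of [p - u] is [(e - p) + u]. Orthogonality to [e - p] follows from [p - u <= p],
    orthogonality to [u] from [p - u <= e - u]. *)
Lemma order_projection_sub e p u :
  order_projection C abs e p -> order_projection C abs e u -> C (p - u) ->
  order_projection C abs e (p - u).
Proof.
move=> /order_projectionP[p_ge0 p_le pp'] /order_projectionP[u_ge0 u_le uu'] up.
have -> : order_projection C abs e (p - u) <->
    [/\ C (p - u), C (e - p + u) & Defs.orthogonal abs (p - u) (e - p + u)].
  by rewrite order_projectionP opprB addrA addrAC.
split=> //; first exact: cone_add.
apply: orthogonal_add => //.
  by apply: orthogonal_le pp' => //; rewrite ?subKr ?subrr //; case: (ao_cone hA).
apply: orthogonal_sym; apply: orthogonal_le uu' => //.
  by rewrite subrr; case: (ao_cone hA).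
by rewrite opprB addrA subrK.
Qed.

Lemma dot_meet_sym u v : dot_meet abs u v = dot_meet abs v u.
Proof. by rewrite /dot_meet abs_sub_sym [u + v]addrC. Qed.

Lemma dot_meet_double u v :
  dot_meet abs u v + dot_meet abs u v = u + v - abs (u - v).
Proof.
by rewrite /dot_meet -scalerDl -[2^-1 in X in X *: _]mul1r -splitr scale1r.
Qed.

Lemma abs_sub_dot_meet u v :
  abs (u - v) = (u - dot_meet abs u v) + (v - dot_meet abs u v).
Proof. by rewrite addrACA -opprD dot_meet_double subKr. Qed.

Lemma dot_meet_le u v : C (u - dot_meet abs u v).
Proof.
have -> : u - dot_meet abs u v = 2^-1 *: (abs (u - v) + (u - v)).
  rewrite abs_sub_dot_meet.
  set m := dot_meet abs u v.
  have -> : u - m + (v - m) + (u - v) = 2 *: (u - m).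
    by rewrite -addrA [v - m + _]addrC [u - v + _]addrA subrK scaler_nat mulr2n.
  by rewrite scalerA mulVf ?scale1r ?pnatr_eq0.
apply: cone_scale; first by rewrite invr_ge0 ler0n.
by have [] := ao_abs_dom hA (u - v).
Qed.

Lemma dot_meet_ler u v : C (v - dot_meet abs u v).
Proof. by rewrite dot_meet_sym; exact: dot_meet_le. Qed.

Lemma orthogonal_dot_meet u v :
  Defs.orthogonal abs (u - dot_meet abs u v) (v - dot_meet abs u v).
Proof. by rewrite /Defs.orthogonal -abs_sub_dot_meet opprB addrA subrK. Qed.

(** Replacing [v] by [e - v] interchanges [u - v] and [u + v - e]. *)
Lemma absolutely_compatible_compl e u v :
  absolutely_compatible C abs e u v -> absolutely_compatible C abs e u (e - v).
Proof.
move=> [uI [v_ge0 v_le] uv]; split=> //.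
  split; rewrite /cone_le ?subr0 ?subKr //.
  by move: v_ge0; rewrite /cone_le subr0.
by rewrite opprB addrA [u + (e - v)]addrCA [e + _]addrC addrK [LHS]addrC.
Qed.

(** The two meets subtract [abs (u - v)] and [abs (u + v - e)], whose sum is [e]; half of [2 *: u]
    remains. *)
Lemma absolutely_compatible_dot_meet e u v :
  absolutely_compatible C abs e u v ->
  dot_meet abs u v + dot_meet abs u (e - v) = u.
Proof.
move=> [_ _ uv]; rewrite /dot_meet -scalerDr [- (e - v)]opprB [u + (v - e)]addrA.
have -> : u + v - abs (u - v) + (u + (e - v) - abs (u + v - e)) = 2 *: u.
  rewrite addrACA -opprD uv [u + (e - v)]addrCA [e + (u - v)]addrC addrA addrK.
  by rewrite addrACA subrr addr0 scaler_nat mulr2n.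
by rewrite scalerA mulVf ?scale1r ?pnatr_eq0.
Qed.

Lemma order_projection_dot_meet e p q :
  order_projection C abs e p -> order_projection C abs e q ->
  absolutely_compatible C abs e p q ->
  order_projection C abs e (dot_meet abs p q).
Proof.
move=> /order_projectionP[_ p'_ge0 pp'] /order_projectionP[_ q'_ge0 qq'].
move=> /absolutely_compatible_dot_meet.
set m := dot_meet abs p q; set n := dot_meet abs p (e - q) => mn.
(* A meet of positive elements need not be positive; here [m = p - n], and [n] is itself a meet with
   [p], hence below [p]. *)
have m_ge0 : C m by rewrite -(addrK n m) mn; exact: dot_meet_le.
have n_ge0 : C n by rewrite -(addKr m n) mn addrC; exact: dot_meet_le.
have m'E : e - m = n + (e - p) by rewrite -mn opprD addrCA [- m - n]addrC addNKr.
apply/order_projectionP; rewrite m'E; split=> //; first exact: cone_add.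
(* [m] is orthogonal to [n] because [m <= q] and [n <= e - q], and to [e - p] because [m <= p]. *)
apply: orthogonal_add => //.
  by apply: orthogonal_le qq' => //; exact: dot_meet_ler.
apply: orthogonal_le pp' => //; first exact: dot_meet_le.
by rewrite subrr; case: (ao_cone hA).
Qed.

End OrderedSpace.

Section OrderUnitSpace.
Context {R : realType} {V : normedModType R} {C : set V} {abs : V -> V} {e : V}.
Hypothesis hV : absolute_order_unit_space C abs e.
Implicit Types (p q u v : V).

Let hA : absolutely_ordered C abs := aou_abs_ordered hV.

Lemma unit_interval_norm v : C v -> C (e - v) -> `|v| <= 1.
Proof.
move=> v_ge0 v_le; rewrite (aou_norm hV); apply: ge_inf.
  by exists 0 => k [/ltW].
by rewrite /= scale1r; split=> //; rewrite -[e](subrK v); do 2?apply: (cone_add hA).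
Qed.

(** The infimum defining the norm is only approached, which gives [v <= (1 + eps) *: e] for every
    [eps > 0]; closedness of the cone allows [eps] to tend to 0. *)
Lemma norm_le1_unit v : `|v| <= 1 -> C (e - v).
Proof.
move=> v_le1.
have e_ge0 : C e.
  (* The order unit property at the vector 0 puts a positive multiple of [e] in the cone. *)
  have [k [k_gt0 /(cone_scale hA) + _]] := aou_unit hV 0.
  move=> /(_ k^-1); rewrite addr0 scalerA mulVf ?gt_eqF// scale1r; apply.
  by rewrite invr_ge0 ltW.
have near_e (eps : R) : 0 < eps -> C ((1 + eps) *: e - v).
  move=> eps_gt0; set S := [set k : R | [/\ 0 < k, C (k *: e + v) & C (k *: e - v)]].
  have infS : has_inf S.
    by split; [exact: aou_unit hV v|exists 0 => k [/ltW]].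
  have [k [k_gt0 _ kv] k_lt] := inf_adherent eps_gt0 infS.
  have k_le : k <= 1 + eps.
    by apply: (le_trans (ltW k_lt)); rewrite lerD2r -(aou_norm hV).
  rewrite -(subrK k (1 + eps)) scalerDl -addrA; apply: (cone_add hA) => //.
  by apply: (cone_scale hA); rewrite ?subr_ge0.
have cvg_e : (1 + n.+1%:R^-1 : R) *: e - v @[n --> \oo] --> e - v.
  rewrite -[X in _ --> X - v]scale1r -[X in _ --> X *: e - v]addr0.
  apply: cvgB; last exact: cvg_cst.
  apply: cvgZr_tmp; apply: cvgD; first exact: cvg_cst.
  exact: cvg_harmonic.
apply: (closed_cvg _ (aou_closed hV) _ _ cvg_e).
by apply: nearW => n; apply: near_e; rewrite invr_gt0 ltr0n.
Qed.

(** Orthogonality gives the norm of [p + q] as the maximum of two norms that are at most 1. *)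
Lemma orthogonal_add_le p q : C p -> C q -> C (e - p) -> C (e - q) ->
  Defs.orthogonal abs p q -> C (e - (p + q)).
Proof.
move=> p_ge0 q_ge0 p_le q_le /(aou_orthogonal hV p_ge0 q_ge0) pq.
have C0 : C 0 by case: (ao_cone hA).
apply: norm_le1_unit.
have /(_ 1 1) : infty_orthogonal p q.
  by apply: pq; split; rewrite /cone_le ?subr0 ?subrr.
by rewrite !scale1r => ->; rewrite ge_max !unit_interval_norm.
Qed.

Lemma absolutely_compatible_of_dot_meet p q :
  order_projection C abs e p -> order_projection C abs e q ->
  order_projection C abs e (dot_meet abs p q) ->
  absolutely_compatible C abs e p q.
Proof.
move=> hp hq hm; split; [by case: hp|by case: hq|].
set m := dot_meet abs p q in hm *.
have m_le_p : C (p - m) := dot_meet_le hA p q.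
have m_le_q : C (q - m) := dot_meet_ler hA p q.
have /order_projectionP[p1_ge0 p1_le _] := order_projection_sub hA hp hm m_le_p.
have /order_projectionP[_ p_le _] := hp.
have /order_projectionP[q_ge0 q_le _] := hq.
have /order_projectionP[m_ge0 m'_ge0 mm'] := hm.
have C0 : C 0 by case: (ao_cone hA).
have p1q : Defs.orthogonal abs (p - m) q.
  (* Split [q] as [(q - m) + m]: [p - m] is orthogonal to [q - m] as the other part of [p - q], and
     to [m] because [p - m <= e - m]. *)
  rewrite -[q](subrK m); apply: (orthogonal_add hA) => //.
    exact: orthogonal_dot_meet.
  apply: (orthogonal_sym hA); apply: (orthogonal_le hA) mm' => //.
    by rewrite subrr.
  by rewrite opprB addrA subrK.
have f_ge0 := orthogonal_add_le p1_ge0 q_ge0 p1_le q_le p1q.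
set f := e - (p - m + q) in f_ge0.
have mf : Defs.orthogonal abs m f.
  apply: (orthogonal_le hA) mm' => //; first by rewrite subrr.
  have -> : e - m - f = (p - m) + (q - m).
    by rewrite /f opprB addrC addrA subrK addrA.
  exact: (cone_add hA).
have -> : p + q - e = m - f.
  by rewrite /f opprB addrA addrA addrCA subrr addr0.
(* The absolute values are now [(p - m) + (q - m)] and [m + f], with total [(p - m + q) + f = e]. *)
rewrite mf abs_sub_dot_meet -/m -addrA [q - m + _]addrA subrK addrA /f.
by rewrite addrC subrK.
Qed.

End OrderUnitSpace.

Theorem theorem5p11 (R : realType) (V : normedModType R)
    (C : set V) (abs : V -> V) (e : V)
    (hV : absolute_order_unit_space C abs e)
    (p q : V)
    (hp : order_projection C abs e p) (hq : order_projection C abs e q) :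
  (order_projection C abs e (dot_meet abs p q) <->
   absolutely_compatible C abs e p q) /\
  (absolutely_compatible C abs e p q <->
   order_projection C abs e (dot_meet abs p q) /\
   order_projection C abs e (dot_meet abs p (e - q))).
Proof.
have hA := aou_abs_ordered hV.
have compatP : order_projection C abs e (dot_meet abs p q) <->
    absolutely_compatible C abs e p q.
  split; first exact: (absolutely_compatible_of_dot_meet hV).
  exact: (order_projection_dot_meet hA).
split=> //; split=> [pq|[/compatP]//]; split; first exact/compatP.
apply: (order_projection_dot_meet hA) => //.
  exact: (order_projection_compl hA).
exact: absolutely_compatible_compl.
Qed.
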